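(* Let $X$ and $X'$ be saturated graphs without bridges and fix $D_1\in \mathrm{Pic}^1(X)$ and $D_1'\in \mathrm{Pic}^1(X')$. Let $\phi:J_{X'}\to J_X$ be a group isomorphism such that for all characters $\chi:J_X\to\mathbb{C}^\times$, $$L(t,u,X,\chi,D_1)=L(t,u,X',\chi\circ\phi,D_1').$$ Then $X$ and $X'$ are isomorphic (as multigraphs).
   Context: Throughout, ''graph'' means an undirected, connected, finite multigraph without loops. For a graph $X$, $V(X)$ is its vertex set. A bridge is an edge whose removal disconnects the graph. A graph is saturated if every pair of (distinct) vertices is connected by at least one edge. For an ordering $v_1,\dots,v_n$ of $V(X)$, the Laplacian matrix is $L_X=D_X-A_X$, where $D_X$ is the diagonal matrix of vertex degrees and $A_X$ is the adjacency matrix (counting edges with multiplicity). $\mathrm{Div}(X)$ is the free abelian group on $V(X)$; its elements are called divisors. The degree of $D=\sum a_iv_i$ is $\deg(D)=\sum a_i$. $D$ is effective if all $a_i\ge 0$; $\mathrm{Div}_+(X)$ is the set of effective divisors. The Picard group is $\mathrm{Pic}(X)=\mathrm{Div}(X)/\mathrm{im}(L_X)$, where $\mathrm{im}(L_X)$ is the image of $L_X$ as a $\mathbb{Z}$-endomorphism of $\mathrm{Div}(X)$; the degree is well defined on it. $\mathrm{Pic}^k(X)$ is the set of classes of degree $k$, and $J_X=\mathrm{Pic}^0(X)$ is the Jacobian, a finite abelian group. Write $D\sim D'$ if $D,D'$ have the same class, and $|D|$ for the set of effective divisors equivalent to $D$. The Riemann--Roch structure is $h(D)=\min\{\deg(E):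 E\in\mathrm{Div}_+(X),\ |D-E|=\emptyset\}$. It depends only on the class of $D$, so $h$ is a function on $\mathrm{Pic}(X)$ with values in $\{0,1,2,\dots\}$. For $D_1\in\mathrm{Pic}^1(X)$ and a character $\chi:J_X\to\mathbb{C}^\times$, the $L$-function is the formal power series in $t$ with coefficients in $\mathbb{C}[u]$ $$L(t,u,X,\chi,D_1)=\sum_{D\in\mathrm{Pic}(X)}\frac{u^{h(D)}-1}{u-1}\,\chi(D-\deg(D)D_1)\,t^{\deg(D)},$$ where $\frac{u^m-1}{u-1}=1+u+\dots+u^{m-1}$ (equal to $0$ when $m=0$). *)

(* Defs.v *)
From HB Require Import structures.
From mathcomp Require Import all_boot all_order all_algebra.
From mathcomp Require Import ring_quotient.
From mathcomp Require Import boolp classical_sets cardinality fsbigop reals.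
From mathcomp Require Import complex.

Set Implicit Arguments.
Unset Strict Implicit.
Unset Printing Implicit Defensive.

Import Order.TTheory GRing.Theory Num.Theory.
Local Open Scope ring_scope.
Local Open Scope quotient_scope.

Section Incidence.
Variables (V E : finType) (ends : E -> {set V}).

Definition adjacent_by (A : {set E}) : rel V :=
  fun x y => [exists e in A, ends e == [set x; y]%SET].

Definition connected_by (A : {set E}) : Prop :=
  forall x y : V, connect (adjacent_by A) x y.

End Incidence.

(* Edges form a type of their own, so parallel edges are allowed; each edge has
   exactly two distinct endpoints, so there are no loops. *)
Record multigraph := Multigraph {
  vertex : finType;
  edge : finType;
  ends : edge -> {set vertex};
  card_ends : forall e, #|ends e| = 2;
  vertex_gt0 : (0 < #|vertex|)%N;
  graph_connected : connected_by ends [set: edge]%SET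
}.

Definition bridge (X : multigraph) (e : edge X) : Prop :=
  ~ connected_by (@ends X) ([set: edge X] :\ e)%SET.

Definition saturated (X : multigraph) : Prop :=
  forall x y : vertex X, x != y -> exists e : edge X, ends e = [set x; y]%SET.

Definition graph_isomorphic (X Y : multigraph) : Prop :=
  exists (f : vertex X -> vertex Y) (g : edge X -> edge Y),
    [/\ bijective f, bijective g & forall e, ends (g e) = (f @: ends e)%SET].

Section Divisors.
Variable X : multigraph.
Local Notation V := (vertex X).

Definition valency (x : V) : nat := #|[set e : edge X | x \in ends e]%SET|.

Definition adjacency (x y : V) : nat :=
  #|[set e : edge X | ends e == [set x; y]]%SET|.

(* The entries of the matrix L_X, indexed by vertices rather than by their
   ranks in a chosen ordering. *)
Definition laplacian (x y : V) : int :=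
  (if x == y then (valency x)%:Z else 0) - (adjacency x y)%:Z.

Definition Div : Type := {ffun V -> int}.
HB.instance Definition _ := GRing.Zmodule.on Div.

Definition ddeg (D : Div) : int := \sum_x D x.

Definition effective (D : Div) : Prop := forall x, 0 <= D x.

Definition lap_map (f : Div) : Div := [ffun x => \sum_y laplacian x y * f y].

Definition principal (D : Div) : bool := `[< exists f : Div, D = lap_map f >].

Lemma lap_map_zmod : zmod_morphism lap_map.
Proof.
move=> f g; apply/ffunP => x; rewrite !ffunE -sumrB.
by apply: eq_bigr => y _; rewrite !ffunE mulrBr.
Qed.

HB.instance Definition _ := GRing.isZmodMorphism.Build Div Div lap_map lap_map_zmod.

Lemma principal_zmod_closed : zmod_closed principal.
Proof.
split=> [|D D']; first by apply/asboolP; exists 0; rewrite raddf0.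
move=> /asboolP[f ->] /asboolP[g ->].
by apply/asboolP; exists (f - g); rewrite raddfB.
Qed.

HB.instance Definition _ := GRing.isZmodClosed.Build Div principal principal_zmod_closed.

Definition im_laplacian : zmodClosed Div := GRing.ZmodClosed.clone Div principal _.

(* Pic(X) = Div(X) / im(L_X), with the library's quotient group structure. *)
Definition Pic : Type := Quotient.quot im_laplacian.
HB.instance Definition _ := GRing.Zmodule.on Pic.

Definition cls (D : Div) : Pic := \pi_Pic D.

(* |D| *)
Definition linear_system (D : Div) : set Div :=
  [set F : Div | effective F /\ cls F = cls D]%classic.

Lemma adjacencyC x y : adjacency x y = adjacency y x.
Proof. by rewrite /adjacency finset.setUC. Qed.

Lemma sum_adjacency x : (\sum_y adjacency x y = valency x)%N.
Proof.
rewrite /adjacency /valency -sum1dep_card.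
under eq_bigr => y _ do rewrite -sum1dep_card big_mkcond /=.
rewrite exchange_big /= [RHS]big_mkcond /=; apply: eq_bigr => e _.
have /eqP/cards2P[a [b [ab ee]]] := card_ends e.
case: ifP => [xe|xNe]; last first.
  rewrite big1 // => y _; case: eqP => // eE.
  by move: xNe; rewrite eE !inE eqxx.
have [c ec cx] : exists2 c, ends e = [set x; c]%SET & c != x.
  move: xe; rewrite ee !inE => /orP[/eqP->|/eqP->].
    by exists b; rewrite // eq_sym.
  by exists a; rewrite // finset.setUC.
rewrite (bigD1 c) //= ec eqxx big1 // => y yc; case: eqP => // /setP/(_ c).
by rewrite !inE eqxx orbT (negbTE cx) eq_sym (negbTE yc).
Qed.

Lemma ddeg_zmod : zmod_morphism ddeg.
Proof. by move=> D D'; rewrite /ddeg -sumrB; apply: eq_bigr => x _; rewrite !ffunE. Qed.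

HB.instance Definition _ := GRing.isZmodMorphism.Build Div int ddeg ddeg_zmod.

Lemma ddeg_lap_map f : ddeg (lap_map f) = 0.
Proof.
rewrite /ddeg; under eq_bigr => x _ do rewrite ffunE.
rewrite exchange_big big1 //= => y _; rewrite -mulr_suml sumrB.
rewrite (bigD1 y) //= eqxx big1 ?addr0 => [|x /negbTE-> //].
suff -> : (valency y)%:Z = \sum_x (adjacency x y)%:Z by rewrite subrr mul0r.
rewrite -sum_adjacency -natz natr_sum; apply: eq_bigr => x _.
by rewrite adjacencyC natz.
Qed.

Lemma cls_eqP D D' : reflect (exists f, D - D' = lap_map f) (cls D == cls D').
Proof. by rewrite -Quotient.idealrBE; apply: asboolP. Qed.

Lemma cls_zmod : zmod_morphism cls.
Proof. exact: raddfB. Qed.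

HB.instance Definition _ := GRing.isZmodMorphism.Build Div Pic cls cls_zmod.

Lemma cls_repr (c : Pic) : cls (repr c) = c.
Proof. exact: reprK. Qed.

Definition pdeg (c : Pic) : int := ddeg (repr c).

Lemma pdeg_cls D : pdeg (cls D) = ddeg D.
Proof.
have /eqP/cls_eqP[f df] := cls_repr (cls D).
by apply/eqP; rewrite -subr_eq0 -raddfB /= df ddeg_lap_map.
Qed.

Lemma pdeg_zmod : zmod_morphism pdeg.
Proof.
by move=> c d; rewrite -[c]cls_repr -[d]cls_repr -raddfB !pdeg_cls raddfB.
Qed.

HB.instance Definition _ := GRing.isZmodMorphism.Build Pic int pdeg pdeg_zmod.

Lemma linear_system_deg_lt0 D : ddeg D < 0 -> linear_system D = set0.
Proof.
move=> dD; apply/seteqP; split=> // F [effF cF] /=.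
move: dD; rewrite -pdeg_cls -cF pdeg_cls ltNge.
by rewrite /ddeg sumr_ge0.
Qed.

Definition kills (D : Div) (n : nat) : bool :=
  `[< exists E : Div, [/\ effective E, ddeg E = n%:Z & linear_system (D - E) = set0] >].

Lemma kills_exists D : exists n, kills D n.
Proof.
have [q _] : exists q : V, q \in predT by apply/card_gt0P; exact: vertex_gt0.
pose n := `|ddeg D|.+1; exists n; apply/asboolP.
pose E : Div := [ffun x => if x == q then n%:Z else 0].
have dE : ddeg E = n%:Z.
  rewrite /ddeg (bigD1 q) //= ffunE eqxx big1 ?addr0 // => x /negbTE xq.
  by rewrite ffunE xq.
exists E; split=> //; first by move=> x; rewrite ffunE; case: ifP.
apply: linear_system_deg_lt0; rewrite raddfB /= dE subr_lt0.
by rewrite (le_lt_trans (ler_norm _)) // -abszE /n ltz_nat.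
Qed.

(* h(D), the least degree of an effective E with |D - E| empty *)
Definition hdiv (D : Div) : nat := ex_minn (kills_exists D).

Lemma hdiv_cls D D' : cls D = cls D' -> hdiv D = hdiv D'.
Proof.
move=> DD'; apply: eq_ex_minn => n; apply: asbool_equiv_eq.
have ls E : linear_system (D - E) = linear_system (D' - E).
  by rewrite /linear_system !raddfB /= DD'.
by split=> -[E [effE dE lE]]; exists E; split=> //; rewrite ?ls // -ls.
Qed.

Definition h (c : Pic) : nat := hdiv (repr c).

Lemma h_cls D : h (cls D) = hdiv D.
Proof. exact/hdiv_cls/cls_repr. Qed.

Lemma h_deg_lt0 c : pdeg c < 0 -> h c = 0%N.
Proof.
move=> dc; apply/eqP; rewrite -leqn0 /h /hdiv; case: ex_minnP => m _; apply.
apply/asboolP; exists 0; split; [by move=> x; rewrite ffunE|by rewrite raddf0|].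
by apply: linear_system_deg_lt0; rewrite subr0.
Qed.

Lemma laplacianC x y : laplacian x y = laplacian y x.
Proof. by rewrite /laplacian adjacencyC eq_sym; case: eqP => // ->. Qed.

Lemma lap_mapE f x : lap_map f x = \sum_y (adjacency x y)%:Z * (f x - f y).
Proof.
rewrite ffunE; under eq_bigr => y _ do rewrite /laplacian mulrBl.
under [RHS]eq_bigr => y _ do rewrite mulrBr.
rewrite !sumrB -mulr_suml; congr (_ - _).
rewrite (bigD1 x) //= eqxx big1 ?addr0; last first.
  by move=> y /negbTE yx; rewrite eq_sym yx mul0r.
congr (_ * _); rewrite -sum_adjacency -natz natr_sum.
by apply: eq_bigr => y _; rewrite natz.
Qed.

Lemma lap_map_eq0 f : lap_map f = 0 -> forall x y, f x = f y.
Proof.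
move=> f0; have [q _] : exists q : V, q \in predT by exact/card_gt0P/vertex_gt0.
have [m _ fm] := @Order.TotalTheory.arg_maxP _ _ V q predT f isT.
suff cst x : f x = f m by move=> x y; rewrite !cst.
have /connectP[p + ->] := @graph_connected X m x.
have := erefl (f m); move: {1 3 4}m => z.
elim: p z => [|y p IHp] z fz //= /andP[zy].
apply: IHp; case/exists_inP: zy => e _ ezy.
have : lap_map f z = 0 by rewrite f0 ffunE.
rewrite lap_mapE => /eqP; rewrite psumr_eq0 => [/allP/(_ y)|w _]; last first.
  by rewrite mulr_ge0 // subr_ge0 fz; exact: fm.
rewrite mem_index_enum => /(_ isT); rewrite mulf_eq0 subr_eq0 => /orP[|/eqP<- //].
rewrite eqz_nat cards_eq0 => /eqP/setP/(_ e).
by rewrite !inE ezy.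
Qed.

Lemma principal_exponent :
  exists2 d : nat, (0 < d)%N & forall D, ddeg D = 0 -> cls (D *+ d) = 0.
Proof.
pose n := #|V|; pose M : 'M[int]_n :=
  \matrix_(i, j) (laplacian (enum_val i) (enum_val j) + 1).
pose fun_of (c : 'cV[int]_n) : Div := [ffun x => c (enum_rank x) 0].
have MC : M^T = M by apply/matrixP => i j; rewrite !mxE laplacianC.
have sumE (F : V -> int) : \sum_x F x = \sum_(i < n) F (enum_val i).
  by rewrite (reindex (fun i : 'I_n => enum_val i)) //=; exact/onW_bij/enum_val_bij.
have ME (c : 'cV[int]_n) :
    fun_of (M *m c) = lap_map (fun_of c) + [ffun=> ddeg (fun_of c)].
  apply/ffunP => x; rewrite !ffunE mxE /ddeg !sumE -big_split /=.
  by apply: eq_bigr => i _; rewrite !mxE !ffunE enum_rankK enum_valK mulrDl mul1r.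
have dcst (a : int) : ddeg [ffun=> a] = a *+ n.
  by rewrite /ddeg; under eq_bigr do rewrite ffunE; rewrite sumr_const.
have deg0 (c : 'cV[int]_n) : ddeg (fun_of (M *m c)) = 0 -> ddeg (fun_of c) = 0.
  rewrite ME raddfD /= ddeg_lap_map add0r dcst => /eqP.
  by rewrite mulrn_eq0 -[n == _]negbK -lt0n vertex_gt0 => /eqP.
have detM : \det M != 0.
  apply/det0P => -[v v0 vM].
  have Mv : M *m v^T = 0 by rewrite -[LHS]trmxK trmx_mul trmxK MC vM trmx0.
  have f0 : fun_of (M *m v^T) = 0 by rewrite Mv; apply/ffunP => x; rewrite !ffunE mxE.
  have d0 : ddeg (fun_of v^T) = 0 by apply: deg0; rewrite f0 raddf0.
  have cst := @lap_map_eq0 (fun_of v^T) _.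
  case/eqP: v0; apply/rowP => i; rewrite mxE.
  have {}cst x : fun_of v^T x = fun_of v^T (enum_val i).
    apply: cst; move: f0; rewrite ME d0 => f0.
    by rewrite -[RHS]f0; apply/ffunP => y; rewrite !ffunE addr0.
  move: d0; rewrite /ddeg (eq_bigr _ (fun x _ => cst x)) sumr_const => /eqP.
  rewrite mulrn_eq0 -[#|_| == _]negbK -lt0n vertex_gt0 /= ffunE mxE enum_valK.
  by move/eqP.
exists `|\det M|%N => [|D D0]; first by rewrite absz_gt0.
suff detD : cls (D *~ \det M) = 0.
  by rewrite pmulrn abszEsg mulrC mulrzA raddfMz /= detD mul0rz.
pose c : 'cV[int]_n := \col_i D (enum_val i).
have Dc : fun_of (M *m (\adj M *m c)) = D *~ \det M.
  rewrite mulmxA mul_mx_adj mul_scalar_mx; apply/ffunP => x.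
  have -> : (D *~ \det M) x = D x *~ \det M.
    by case: (\det M) => m; rewrite -?pmulrn ?NegzE ?mulrNz -?pmulrn ?ffunE ffunMnE.
  by rewrite !ffunE !mxE enum_rankK mulrC -mulrzr intz.
have d0 : ddeg (fun_of (\adj M *m c)) = 0.
  by apply: deg0; rewrite Dc raddfMz /= D0 mul0rz.
apply/eqP; rewrite -(raddf0 cls); apply/cls_eqP; exists (fun_of (\adj M *m c)).
by rewrite subr0 -Dc ME d0; apply/ffunP => x; rewrite !ffunE addr0.
Qed.

Lemma finite_pic k : finite_set [set c : Pic | pdeg c = k]%classic.
Proof.
have [d d0 dP] := principal_exponent.
have [q _] : exists q : V, q \in predT by exact/card_gt0P/vertex_gt0.
pose red (r : {ffun V -> 'I_d}) : Div :=
  [ffun x => if x == q then k - \sum_(y | y != q) (r y)%:Z else (r x)%:Z].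
apply: (sub_finite_set (B := ((cls \o red) @` setT)%classic)); last first.
  exact/finite_image/finite_finset.
move=> c /= ck.
have rP x : (`|(repr c x %% d)%Z| < d)%N.
  by rewrite -ltz_nat gez0_abs ?modz_ge0 ?ltz_pmod // -?lt0n //; case: (d) d0.
pose r : {ffun V -> 'I_d} := [ffun x => Ordinal (rP x)].
exists r => //=; rewrite -[RHS]cls_repr.
pose e : Div := [ffun x => if x == q then - \sum_(y | y != q) (repr c y %/ d)%Z
                           else (repr c x %/ d)%Z].
have e0 : ddeg e = 0.
  rewrite /ddeg (bigD1 q) //= ffunE eqxx addrC; apply/eqP; rewrite subr_eq0.
  by apply/eqP/eq_bigr => x /negbTE xq; rewrite ffunE xq.
apply/eqP; rewrite eq_sym -subr_eq0 -raddfB /=.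
suff -> : repr c - red r = e *+ d by rewrite dP.
have rE x : (r x)%:Z = (repr c x %% d)%Z.
  by rewrite ffunE /= gez0_abs // modz_ge0 // -lt0n.
have subE (f g : Div) x : (f - g) x = f x - g x by rewrite !ffunE.
have off x : x != q -> (repr c - red r) x = (e *+ d) x.
  move=> /negbTE xq; rewrite ffunMnE subE [red r x]ffunE [e x]ffunE xq rE.
  by rewrite [X in X - _](divz_eq _ d) addrK -mulr_natr natz.
apply/ffunP => x; have [->|/off//] := eqVneq x q.
have : ddeg (repr c - red r) = ddeg (e *+ d).
  rewrite [RHS]raddfMn /= e0 mul0rn raddfB /=; apply/eqP; rewrite subr_eq0 -/(pdeg c) ck.
  rewrite /ddeg (bigD1 q) //= [red r q]ffunE eqxx [X in _ + X](eq_bigr (fun y => (r y)%:Z)).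
    by rewrite subrK.
  by move=> y /negbTE yq; rewrite [LHS]ffunE yq.
by rewrite /ddeg !(bigD1 q (P := predT)) //= (eq_bigr _ off) => /addIr.
Qed.

Definition pic0 (c : Pic) : bool := pdeg c == 0.

Lemma pic0_zmod_closed : zmod_closed pic0.
Proof.
split=> [|c d]; rewrite !unfold_in ?raddf0 //.
by move=> /eqP dc /eqP dd; rewrite raddfB /= dc dd.
Qed.

HB.instance Definition _ := GRing.isZmodClosed.Build Pic pic0 pic0_zmod_closed.

Definition Jac : Type := {c : Pic | pic0 c}.
HB.instance Definition _ := SubChoice.on Jac.
HB.instance Definition _ := [SubChoice_isSubZmodule of Jac by <:].

Definition Pic1 : Type := {c : Pic | pdeg c == 1}.

Lemma shift_deg0 (c : Pic) (D1 : Pic1) : pic0 (c - val D1 *~ pdeg c).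
Proof.
by rewrite /pic0 raddfB raddfMz /= (eqP (valP D1)) intz subrr.
Qed.

(* D - deg(D) D_1 *)
Definition shift (c : Pic) (D1 : Pic1) : Jac := exist (fun c => is_true (pic0 c)) _ (shift_deg0 c D1).

Section LFunction.
Variable R : realType.

(* Non-vanishing expresses that the values lie in C^* *)
Definition is_character (chi : Jac -> R[i]) : Prop :=
  (forall a, chi a != 0) /\ forall a b, chi (a + b) = chi a * chi b.

(* The value at k : int is the coefficient of t^k, a polynomial in u = 'X. The
   sum ranges over the finite set Pic^k(X) (see finite_pic), and it is 0 for
   k < 0 (see Lfun_lt0). *)
Definition Lfun (chi : Jac -> R[i]) (D1 : Pic1) : int -> {poly R[i]} :=
  fun k => \sum_(c \in [set c : Pic | pdeg c = k]%classic)
             chi (shift c D1) *: \sum_(i < h c) 'X^i.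

Lemma Lfun_lt0 chi D1 k : k < 0 -> Lfun chi D1 k = 0.
Proof.
move=> k0; apply: fsbig1 => c /= ck.
by rewrite h_deg_lt0 ?ck // big_ord0 scaler0.
Qed.

End LFunction.

End Divisors.

(* Main.v *)
From HB Require Import structures.
Require Import Defs.
From mathcomp Require Import all_boot all_order all_algebra.
From mathcomp Require Import cyclic separable cyclotomic.
From mathcomp Require Import boolp classical_sets cardinality fsbigop.
From mathcomp Require Import reals complex.

Set Implicit Arguments.
Unset Strict Implicit.
Unset Printing Implicit Defensive.

Import Order.TTheory GRing.Theory Num.Theory.
Local Open Scope ring_scope.

(** Only the constant term in [u] of the coefficient of [t] is needed.  A class
    [c] of degree one contributes to it exactly when [h c > 0], that is, when
    [c] is effective, and the effective classes of degree one are the classes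
    [[v]] of the vertices, which are pairwise distinct in a saturated graph
    without bridges ([cls_vertex_div_inj]).  Hence the hypothesis says that

      sum over [v] of [chi ([v] - D1)]
        = sum over [v'] of [chi (phi ([v'] - D1'))]

    for every character [chi] of the Jacobian of [X].  Characters of a finite
    abelian group separate points, so the two families of elements agree up to
    order ([character_sums_perm_eq]): there is a bijection [F] between the
    vertex sets with [[F v'] - D1 = phi ([v'] - D1')].

    Since the vertices generate all divisors, [F] then carries the principal
    divisors of [X'] onto those of [X] ([principal_pull]).  It remains to
    recover a saturated graph from its lattice of principal divisors, that is,
    from the image of the Laplacian [L].  If [L f] is nonpositive off [v] and
    not zero, then by the maximum principle [f] has a strict maximum at [v]
    ([lap_map_peak]), so that [L f] is at least the valency of [v] at [v], with
    equality only if [L f] is the column of [L] at [v].  So that column is the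
    element of the lattice, nonpositive off [v] and nonzero, with the least
    value at [v].  Its other entries are the edge multiplicities at [v], and a
    multigraph is determined up to isomorphism by its edge multiplicities. *)

(** * Potentials on a graph and the chip-firing map *)

Section Potentials.
Variable X : multigraph.
Local Notation V := (vertex X).
Implicit Types (v w x y : V) (f : Div X).

Definition vertex_div v : Div X := [ffun x => (x == v)%:R].

Lemma ddeg_vertex_div v : ddeg (vertex_div v) = 1.
Proof.
rewrite /ddeg (bigD1 v) //= ffunE eqxx big1 ?addr0 // => x /negbTE xv.
by rewrite ffunE xv.
Qed.

Lemma adjacencyxx x : adjacency x x = 0%N.
Proof.
apply: eq_card0 => e; rewrite !inE.
by apply/negbTE/eqP => ee; have := card_ends e; rewrite ee finset.setUid cards1.
Qed.

Lemma adjacency_gt0 x y : saturated X -> x != y -> (0 < adjacency x y)%N.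
Proof.
by move=> satX /satX[e ee]; apply/card_gt0P; exists e; rewrite inE ee.
Qed.

Lemma lap_map_vertex_div v x : x != v -> lap_map (vertex_div v) x = - (adjacency x v)%:Z.
Proof.
move=> xv; rewrite lap_mapE (bigD1 v) //= !ffunE (negbTE xv) eqxx sub0r mulrN1.
rewrite big1 ?addr0 // => y yv.
by rewrite !ffunE (negbTE yv) subrr mulr0.
Qed.

Lemma incident_edge (A : {set edge X}) v w :
  connected_by (@ends X) A -> v != w -> exists2 e, e \in A & v \in ends e.
Proof.
move=> connA; have /connectP[[|y p] /= + ->] := connA v w; first by rewrite eqxx.
by case/andP=> /exists_inP[e eA /eqP ee] _ _; exists e; rewrite // ee set21.
Qed.

(** The edge joining [v] to the rest of the graph may be removed without
    disconnecting it, so [v] lies on a second edge. *)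
Lemma valency_gt1 v w :
  (forall e : edge X, ~ bridge e) -> v != w -> (1 < valency v)%N.
Proof.
move=> nobr vw; have [e _ ve] := incident_edge (@graph_connected X) vw.
have [e' + ve'] := incident_edge (contrapT (nobr e)) vw.
rewrite !inE => /andP[e'e _].
rewrite /valency (cardD1 e) (cardD1 e') !inE ve ve' /= e'e.
by rewrite addnA.
Qed.

(** No term of the sum is negative at a maximum of [f], and saturation provides
    an edge between [x] and [y], whose term is positive. *)
Lemma lap_map_max_gt0 f x y :
  saturated X -> (forall z, f z <= f x) -> f y < f x -> 0 < lap_map f x.
Proof.
move=> satX fx fy; rewrite lap_mapE (bigD1 y) //=.
apply: ltr_pwDl; last by rewrite sumr_ge0 // => z _; rewrite mulr_ge0 ?subr_ge0.
rewrite mulr_gt0 ?subr_gt0 // ltz_nat adjacency_gt0 //.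
by apply: contraTneq fy => ->; rewrite ltxx.
Qed.

(** Maximum principle: by [lap_map_max_gt0] the Laplacian of a nonconstant [f]
    is positive wherever [f] is maximal, and it may be positive at [v] only. *)
Lemma lap_map_peak f v x : saturated X ->
    (forall w, w != v -> lap_map f w <= 0) -> lap_map f x != 0 ->
  forall w, w != v -> f w < f v.
Proof.
move=> satX fv fx w wv.
have [m _ fm] := @Order.TotalTheory.arg_maxP _ _ V v predT f isT.
have {}fm z : f z <= f m by exact: fm.
have [y fy] : exists y, f y < f m.
  apply: contrapT => /forallNP cst; case/eqP: fx; rewrite lap_mapE big1 // => y _.
  have eqm z : f z = f m by apply/le_anti; rewrite fm //= leNgt; apply/negP.
  by rewrite !eqm subrr mulr0.
have maxv z : f z = f m -> z = v.
  move=> fz; apply: contrapT => /eqP /fv; rewrite leNgt => /negP; apply.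
  by apply: (@lap_map_max_gt0 _ _ y) => //; rewrite fz.
rewrite -(maxv m erefl) lt_neqAle fm // andbT.
by apply: contra wv => /eqP /maxv ->.
Qed.

(** For a peak of integral height the sum consists of nonnegative terms: it
    measures by how much [f] drops too fast to give the column of the Laplacian
    at [v]. *)
Lemma lap_map_peakE f v :
  lap_map f v = (valency v)%:Z + \sum_y (adjacency v y)%:Z * (f v - f y - 1).
Proof.
rewrite lap_mapE -sum_adjacency -natz natr_sum -big_split; apply: eq_bigr => y _.
by rewrite /= natz [in RHS]mulrBr mulr1 addrC subrK.
Qed.

Lemma lap_map_vertex_divxx v :
  lap_map (vertex_div v) v = (valency v)%:Z.
Proof.
rewrite lap_map_peakE big1 ?addr0 // => y _; rewrite !ffunE eqxx.
have [->|yv] := eqVneq y v; first by rewrite adjacencyxx mul0r.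
by rewrite subr0 subrr mulr0.
Qed.

Lemma peak_excess_ge0 f v y : (forall w, w != v -> f w < f v) ->
  0 <= (adjacency v y)%:Z * (f v - f y - 1).
Proof.
move=> fv; have [->|yv] := eqVneq y v; first by rewrite adjacencyxx mul0r.
by rewrite mulr_ge0 // subr_ge0 -gtz0_ge1 subr_gt0 fv.
Qed.

Lemma valency_le_peak f v :
  (forall w, w != v -> f w < f v) -> (valency v)%:Z <= lap_map f v.
Proof.
by move=> fv; rewrite lap_map_peakE lerDl sumr_ge0 // => y _; exact: peak_excess_ge0.
Qed.

(** When the excess in [lap_map_peakE] vanishes, [f] drops by exactly one from
    [v] to each of the other vertices, so it is the indicator of [v] up to a
    constant. *)
Lemma peak_valency_eq f v w : saturated X ->
    (forall w, w != v -> f w < f v) -> lap_map f v = (valency v)%:Z ->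
  w != v -> lap_map f w = - (adjacency w v)%:Z.
Proof.
move=> satX fv /eqP; rewrite lap_map_peakE -subr_eq0 addrAC subrr add0r.
rewrite psumr_eq0 => [/allP s0|y _]; last exact: peak_excess_ge0.
have {s0} fE y : y != v -> f v - f y = 1.
  move=> yv; have := s0 y; rewrite mem_index_enum => /(_ isT).
  have /gtn_eqF adj0 : (0 < adjacency v y)%N by rewrite adjacency_gt0 // eq_sym.
  by rewrite mulf_eq0 eqz_nat adj0 /= subr_eq0 => /eqP.
have fE' y : y != v -> f y = f v - 1 by move=> /fE <-; rewrite opprB addrC subrK.
move=> wv; rewrite lap_mapE (bigD1 v) //= big1 ?addr0 => [|y yv].
  by rewrite fE' // addrAC subrr add0r mulrN1.
by rewrite (fE' w wv) (fE' y yv) subrr mulr0.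
Qed.

(** If [v - w = L f] with [v] and [w] distinct, then [f] has a strict peak at
    [v], so the value 1 of [v - w] at [v] bounds the valency of [v], whereas the
    absence of bridges makes that valency at least two. *)
Lemma cls_vertex_div_inj : saturated X -> (forall e : edge X, ~ bridge e) ->
  injective (fun v => cls (vertex_div v)).
Proof.
move=> satX nobr v w vw; apply: contrapT => /eqP neq.
have /cls_eqP[f fE] : cls (vertex_div v) == cls (vertex_div w) by apply/eqP.
have subE y : lap_map f y = (y == v)%:R - (y == w)%:R by rewrite -fE !ffunE.
have := valency_gt1 nobr neq; rewrite ltnNge => /negP; apply.
rewrite -lez_nat.
have -> : 1%N%:Z = lap_map f v by rewrite subE eqxx (negbTE neq) subr0.
apply/valency_le_peak/(@lap_map_peak _ _ w) => //.
  by move=> y /negbTE yv; rewrite subE yv sub0r oppr_le0; case: eqP.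
by rewrite subE eqxx (eq_sym w) (negbTE neq) sub0r oppr_eq0.
Qed.

End Potentials.

(** * Recovering edge multiplicities from the lattice of principal divisors *)

Section LaplacianLattice.
Variables (X Y : multigraph) (F : vertex X -> vertex Y).
Hypotheses (satX : saturated X) (satY : saturated Y) (F_inj : injective F).
Hypothesis pullF :
  forall D : Div Y, principal D -> principal ([ffun x => D (F x)] : Div X).

(** The column of the Laplacian of [Y] at [F v] pulls back to a principal
    divisor of [X] that is a candidate for the column of [X] at [v]. *)
Lemma pulled_column v : exists f : Div X,
  [/\ forall w, w != v -> f w < f v,
      lap_map f v = (valency (F v))%:Z &
      forall w, w != v -> lap_map f w = - (adjacency (F w) (F v))%:Z].
Proof.
have /pullF/asboolP[f fE] : principal (lap_map (vertex_div (F v))).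
  by apply/asboolP; exists (vertex_div (F v)).
have fF x : lap_map f x = lap_map (vertex_div (F v)) (F x) by rewrite -fE ffunE.
have fw w : w != v -> lap_map f w = - (adjacency (F w) (F v))%:Z.
  by move=> wv; rewrite fF lap_map_vertex_div // (inj_eq F_inj).
exists f; split=> //; last by rewrite fF lap_map_vertex_divxx.
move=> w wv; apply: (@lap_map_peak _ _ _ w) => // [y yv|].
  by rewrite fw // oppr_le0.
by rewrite fw // oppr_eq0 eqz_nat gtn_eqF // adjacency_gt0 // (inj_eq F_inj).
Qed.

Lemma valency_le_pull v : (valency v <= valency (F v))%N.
Proof.
by have [f [pk fv _]] := pulled_column v; rewrite -lez_nat -fv valency_le_peak.
Qed.

(** The inequality [valency_le_pull], used in both directions of a bijection,
    supplies the equality of valencies; then the pulled back column attains the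
    minimum that only the column of [X] at [y] attains. *)
Lemma adjacency_pull x y :
  valency (F y) = valency y -> adjacency x y = adjacency (F x) (F y).
Proof.
have [->|xy] := eqVneq x y; first by rewrite !adjacencyxx.
move=> vy; have [f [pk fv fw]] := pulled_column y.
apply/eqP; rewrite -eqz_nat -eqr_opp -fw //; apply/eqP/esym.
by apply: peak_valency_eq => //; rewrite fv vy.
Qed.

End LaplacianLattice.

(** * From edge multiplicities to an isomorphism of multigraphs *)

(** The bijection sends the k-th element of each fibre of [p] to the k-th
    element of the fibre of [q] over the same point. *)
Lemma equal_fibers_bij (A B T : finType) (p : A -> T) (q : B -> T) :
    (forall t, #|[set a | p a == t]%SET| = #|[set b | q b == t]%SET|) ->
  exists2 g : A -> B, bijective g & forall a, q (g a) = p a.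
Proof.
move=> pq.
have gP a : exists b, q b = p a /\
   index b (enum [set b | q b == p a]%SET) = index a (enum [set a' | p a' == p a]%SET).
  set s := enum [set b | _]%SET; set r := enum _.
  have lt_r : (index a r < size s)%N.
    by rewrite -cardE -pq cardE index_mem mem_enum inE.
  (* The default element for [nth] exists because the fibre over [p a] is nonempty. *)
  have [b0 _] : exists b, b \in s by case: (s) lt_r => // b s' _; exists b; rewrite mem_head.
  exists (nth b0 s (index a r)); split; last by rewrite index_uniq ?enum_uniq.
  by have := mem_nth b0 lt_r; rewrite mem_enum inE => /eqP.
have [g gE] := choice gP; exists g => [|a]; last by case: (gE a).
have card_fibers (C : finType) (r : C -> T) : #|C| = (\sum_t #|[set c | r c == t]%SET|)%N.
  rewrite -sum1_card (partition_big r predT) //=; apply: eq_bigr => t _.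
  by rewrite sum1dep_card; apply: eq_card => c; rewrite !inE.
have card_eq : #|A| = #|B| by rewrite (card_fibers _ p) (card_fibers _ q); apply: eq_bigr.
apply: inj_card_bij; last by rewrite card_eq.
move=> a a' eq_g; have [qa ia] := gE a; have [qa' ia'] := gE a'.
have paa' : p a = p a' by rewrite -qa -qa' eq_g.
pose r := enum [set x | p x == p a]%SET.
have ii : index a r = index a' r by rewrite -ia eq_g paa' ia' /r paa'.
by rewrite -[a](nth_index a (s := r)) ?ii ?nth_index ?mem_enum ?inE ?paa'.
Qed.

(** Edges are matched by applying [equal_fibers_bij] to the endpoint maps.  The
    fibre over a set that is not a pair of vertices is empty on both sides. *)
Lemma adjacency_graph_isomorphic (X Y : multigraph) (F : vertex X -> vertex Y) :
    bijective F -> (forall x y, adjacency x y = adjacency (F x) (F y)) ->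
  graph_isomorphic X Y.
Proof.
move=> Fbij adjF; have Finj := bij_inj Fbij; have [G FK GK] := Fbij.
suff [g gbij gE] : exists2 g : edge X -> edge Y, bijective g &
    forall e, ends (g e) = (F @: ends e)%SET by exists F, g.
apply: equal_fibers_bij => t.
have [/cards2P[a [b [_ ->]]]|tN2] := boolP (#|t| == 2).
  rewrite -[a]GK -[b]GK -[RHS]adjF; apply: eq_card => e; rewrite !inE.
  by rewrite -imset_set1 -[in [set F (G b)]%SET]imset_set1 -imsetU (inj_eq (imset_inj Finj)).
rewrite !eq_card0 // => e; rewrite !inE; apply: contraNF tN2 => /eqP <-.
  by rewrite card_ends.
by rewrite card_imset ?card_ends.
Qed.

(** * Characters of the Jacobian *)

Lemma prim_root_exists (F : closedFieldType) n :
  n%:R != 0 :> F -> exists z : F, n.-primitive_root z.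
Proof.
move=> n0; have n_gt0 : (0 < n)%N by rewrite lt0n; apply: contraNneq n0 => ->.
have [rs rsE] := closed_field_poly_normal ('X^n - 1 : {poly F}).
rewrite (monicP _) ?monicXnsubC // scale1r in rsE.
suff /hasP[z _ zP] : has n.-primitive_root rs by exists z.
apply: has_prim_root => //.
- by apply/allP => z; rewrite -root_prod_XsubC -rsE.
- by rewrite -separable_prod_XsubC -rsE separable_Xn_sub_1.
- by rewrite -ltnS -(size_prod_XsubC rs id) -rsE size_XnsubC.
Qed.

Section Characters.
Variables (R : realType) (X : multigraph).
Local Notation V := (vertex X).

(** By the Smith normal form, the image of the Laplacian is cut out, in suitable
    integral coordinates [l i], by divisibility by the invariant factors.  A
    divisor outside the image fails one of these conditions.  The corresponding
    factor is not 0: for a divisor of degree 0, some positive multiple lies in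
    the image, which forces the coordinates with zero factor to vanish. *)
Lemma principal_functional (D : Div X) : ddeg D = 0 -> ~~ principal D ->
  exists (d : nat) (l : {additive Div X -> int}),
    [/\ (0 < d)%N, forall D', principal D' -> (d %| l D')%Z & ~~ (d %| l D)%Z].
Proof.
move=> D0 DN.
pose n := #|V|; pose M : 'M[int]_n := \matrix_(i, j) laplacian (enum_val i) (enum_val j).
pose col_of (f : Div X) : 'cV[int]_n := \col_i f (enum_val i).
have col_lap f : col_of (lap_map f) = M *m col_of f.
  apply/colP => i; rewrite !mxE ffunE.
  rewrite (reindex (fun i : 'I_n => enum_val i)) /=; last exact/onW_bij/enum_val_bij.
  by apply: eq_bigr => j _; rewrite !mxE.
have [P Pu [Q Qu [d _ ME]]] := int_Smith_normal_form M.
pose l i (f : Div X) : int := (invmx P *m col_of f) i 0.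
have l_add i : zmod_morphism (l i).
  move=> f g; rewrite /l; have -> : col_of (f - g) = col_of f - col_of g.
    by apply/colP => j; rewrite !mxE !ffunE.
  by rewrite mulmxBr !mxE.
have l_lap i f : l i (lap_map f) = d`_i * (Q *m col_of f) i 0.
  rewrite /l col_lap ME -!mulmxA mulKmx // mxE (bigD1 i) //= mxE eqxx mulr1n.
  rewrite big1 ?addr0 // => j ji; rewrite mxE.
  by rewrite (negbTE (_ : _ != _ :> nat)) ?mulr0n ?mul0r // eq_sym.
have l_prin i D' : principal D' -> (d`_i %| l i D')%Z.
  by move=> /asboolP[f ->]; rewrite l_lap dvdz_mulr.
pose L i : {additive Div X -> int} :=
  HB.pack (l i) (GRing.isZmodMorphism.Build _ _ _ (l_add i)).
have [i iN] : exists i, ~~ (d`_i %| l i D)%Z.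
  apply: contrapT => /forallNP all_dvd; case/negP: DN; apply/asboolP.
  pose q : 'cV[int]_n := \col_i (l i D %/ d`_i)%Z.
  exists [ffun x => (invmx Q *m q) (enum_rank x) 0].
  have colK : col_of [ffun x => (invmx Q *m q) (enum_rank x) 0] = invmx Q *m q.
    by apply/colP => i; rewrite mxE ffunE enum_valK.
  suff: col_of D = col_of (lap_map [ffun x => (invmx Q *m q) (enum_rank x) 0]).
    move=> colE; apply/ffunP => x.
    by have := congr1 (fun c : 'cV_n => c (enum_rank x) 0) colE; rewrite !mxE enum_rankK.
  rewrite -[LHS](mulKVmx Pu) -[RHS](mulKVmx Pu); congr (_ *m _).
  apply/colP => i; rewrite -![(invmx P *m _) _ _]/(l i _) l_lap colK mulKVmx //.
  by rewrite mxE mulrC divzK //; apply: contrapT => /negP; exact: all_dvd.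
exists (absz d`_i), (L i); split=> [|D' /l_prin|]; last 1 first.
- by move: iN; rewrite !dvdzE.
- rewrite absz_gt0; apply: contraNneq iN => di0; rewrite di0 dvd0z.
  have [m m0 mP] := principal_exponent X.
  have /eqP := mP D D0; rewrite -[0](raddf0 (@cls X)) => /cls_eqP[f].
  rewrite subr0 => mE; have : l i (D *+ m) = 0 by rewrite mE l_lap di0 mul0r.
  rewrite -[l i]/(L i : _ -> _) raddfMn /= => /eqP.
  by rewrite mulrn_eq0 eqn0Ngt m0.
- by move=> /(_ i); rewrite !dvdzE.
Qed.

(** A functional as in [principal_functional] induces a map from the Jacobian to
    the integers modulo [d] that does not vanish at [a]; composing it with a
    primitive [d]-th root of unity gives the character. *)
Lemma nontrivial_character_value (a : Jac X) : a != 0 ->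
  exists2 chi : Jac X -> R[i], is_character chi & chi a != 1.
Proof.
move=> a0; pose D : Div X := repr (val a).
have aE : cls D = val a by exact: cls_repr.
have D0 : ddeg D = 0 by rewrite -pdeg_cls aE; exact/eqP/(valP a).
have DN : ~~ principal D.
  apply: contra a0 => /asboolP[f fE]; rewrite -val_eqE /= -aE -(raddf0 (@cls X)).
  by apply/cls_eqP; exists f; rewrite subr0.
have [d [l [d0 l_prin lD]]] := principal_functional D0 DN.
have [z zP] : exists z : R[i], d.-primitive_root z.
  by apply: prim_root_exists; rewrite pnatr_eq0 -lt0n.
have z0N : z != 0 by rewrite (prim_root_eq0 zP) -lt0n.
have z0 : z \is a GRing.unit by rewrite unitfE.
have zd m : (z ^ m == 1) = (d %| m)%Z.
  by rewrite dvdzE; case: m => m; rewrite ?NegzE /= ?invr_eq1 -(prim_order_dvd zP).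
have z_cls D1 D2 : cls D1 = cls D2 -> z ^ l D1 = z ^ l D2.
  move=> /eqP/cls_eqP[f fE]; rewrite -[D1](subrK D2) fE raddfD /= expfzDr //.
  suff /eqP-> : z ^ l (lap_map f) == 1 by rewrite mul1r.
  by rewrite zd l_prin //; apply/asboolP; exists f.
exists (fun b => z ^ l (repr (val b))); last by rewrite zd.
split=> [b|b c]; first by rewrite -unitfE unitrXz.
rewrite -expfzDr // -raddfD; apply: z_cls.
by rewrite [RHS]raddfD /= !cls_repr.
Qed.

Definition trivial_character (a : Jac X) : R[i] := 1.

Lemma trivial_is_character : is_character trivial_character.
Proof. by split=> [a|a b]; rewrite ?oner_neq0 // /trivial_character mulr1. Qed.

Lemma is_characterM (chi psi : Jac X -> R[i]) :
  is_character chi -> is_character psi -> is_character (fun a => chi a * psi a).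
Proof.
move=> [chi0 chiD] [psi0 psiD]; split=> [a|a b]; first by rewrite mulf_neq0.
by rewrite chiD psiD mulrACA.
Qed.

Lemma characters_separate_points (a b : Jac X) : a != b ->
  exists2 chi : Jac X -> R[i], is_character chi & chi a != chi b.
Proof.
rewrite -subr_eq0 => /nontrivial_character_value[chi [chi0 chiD] chi1].
exists chi => //; apply: contra chi1 => /eqP chiab.
by rewrite -(inj_eq (mulIf (chi0 b))) -chiD subrK mul1r chiab.
Qed.

(** The span of the characters is stable under multiplication by
    [psi - psi b], so products of such functions have the same sum over [s] and
    over [t].  Taking one factor for each entry [b] different from [a], with
    [psi] separating [b] from [a], leaves only the entries equal to [a], and the
    two sums count them. *)
Lemma character_sums_perm_eq (s t : seq (Jac X)) :
    (forall chi : Jac X -> R[i], is_character chi ->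
       \sum_(a <- s) chi a = \sum_(a <- t) chi a) ->
  perm_eq s t.
Proof.
move=> eq_st; apply/allP => a _ /=.
(* Carrying an arbitrary character along makes the induction go through. *)
have [w wP [wa w0]] : exists2 w : Jac X -> R[i],
    forall chi : Jac X -> R[i], is_character chi ->
      \sum_(b <- s) chi b * w b = \sum_(b <- t) chi b * w b &
    w a != 0 /\ {in s ++ t, forall b, b != a -> w b = 0}.
  elim: (s ++ t) => [|b r [w wP [wa w0]]].
    exists trivial_character => [chi chiP|]; last by split=> //; exact: oner_neq0.
    by under eq_bigr do rewrite mulr1; under [in RHS]eq_bigr do rewrite mulr1; exact: eq_st.
  have [->|ba] := eqVneq b a.
    exists w => //; split=> // c; rewrite inE => /orP[/eqP->|]; first by rewrite eqxx.
    exact: w0.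
  have [psi psiP psiab] := characters_separate_points ba.
  exists (fun c => (psi c - psi b) * w c) => [chi chiP|].
    have split_sum (r' : seq (Jac X)) : \sum_(c <- r') chi c * ((psi c - psi b) * w c) =
        \sum_(c <- r') (chi c * psi c) * w c - psi b * \sum_(c <- r') chi c * w c.
      rewrite mulr_sumr -sumrB; apply: eq_bigr => c _.
      by rewrite mulrA mulrBr mulrBl [chi c * psi b]mulrC !mulrA.
    rewrite !split_sum (wP _ chiP); congr (_ - _).
    exact: (wP _ (is_characterM chiP psiP)).
  split; first by rewrite mulf_neq0 // subr_eq0 eq_sym.
  move=> c; rewrite inE => /orP[/eqP-> _|cr ca]; first by rewrite subrr mul0r.
  by rewrite w0 ?mulr0.
have sumE r : {subset r <= s ++ t} -> \sum_(b <- r) w b = w a *+ count_mem a r.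
  move=> rst; rewrite (bigID (pred1 a)) /= [X in _ + X]big1_seq; last first.
    by move=> b /andP[ba /rst br]; rewrite w0.
  rewrite addr0 (eq_bigr (fun=> w a)) => [|b /eqP-> //].
  by rewrite big_const_seq iter_addr_0.
have sub_s : {subset s <= s ++ t} by move=> b bs; rewrite mem_cat bs.
have sub_t : {subset t <= s ++ t} by move=> b bt; rewrite mem_cat bt orbT.
have := wP _ trivial_is_character.
under eq_bigr do rewrite mul1r; under [in RHS]eq_bigr do rewrite mul1r.
rewrite (sumE s sub_s) (sumE t sub_t) => /eqP.
by rewrite (inj_eq (mulrIn wa)).
Qed.

End Characters.

(** * Effective classes of degree one and the L-function *)

Section EffectiveClasses.
Variable X : multigraph.
Local Notation V := (vertex X).

Lemma effective_deg0 (D : Div X) : effective D -> ddeg D = 0 -> D = 0.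
Proof.
move=> effD /eqP; rewrite psumr_eq0 => [/allP D0|x _]; last exact: effD.
by apply/ffunP => x; rewrite ffunE; apply/eqP/D0; rewrite mem_index_enum.
Qed.

Lemma effective_deg1 (D : Div X) : effective D -> ddeg D = 1 -> exists v, D = vertex_div v.
Proof.
move=> effD D1; have [v v0] : exists v, D v != 0.
  apply: contrapT => /forallNP D0; have : ddeg D != 0 by rewrite D1.
  by case/negP; rewrite /ddeg big1 // => x _; apply/eqP/negPn/negP/D0.
exists v; apply/eqP; rewrite -subr_eq0; apply/eqP/effective_deg0.
  move=> x; rewrite !ffunE; case: eqP => [->|_]; last by rewrite subr0 effD.
  by rewrite subr_ge0 -gtz0_ge1 lt_neqAle eq_sym v0 effD.
by rewrite raddfB /= D1 ddeg_vertex_div subrr.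
Qed.

(** The value 0 of [h] can only be realised by the zero divisor. *)
Lemma h_gt0P (c : Pic X) : (0 < h c)%N <-> exists2 D, effective D & cls D = c.
Proof.
rewrite /h /hdiv lt0n; case: ex_minnP => m /asboolP[E [effE dE lE]] min_m; split.
  move=> m0; apply: contrapT => noD; case/negP: m0; rewrite -leqn0; apply: min_m.
  apply/asboolP; exists 0; split; [by move=> x; rewrite ffunE|by rewrite raddf0|].
  apply/seteqP; split=> // D [effD DE] /=; apply: noD; exists D => //.
  by rewrite DE subr0 cls_repr.
move=> [D effD Dc]; apply/eqP => m0; rewrite m0 in dE.
have E0 := effective_deg0 effE dE; rewrite E0 subr0 in lE.
suff: linear_system (repr c) D by rewrite lE.
by split; rewrite ?cls_repr.
Qed.

(** The constant term of [1 + u + ... + u ^ (h c - 1)] is 1 or 0 according to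
    whether [c] is effective. *)
Lemma Lfun_deg1_coef0 (R : realType) (chi : Jac X -> R[i]) (D1 : Pic1 X) :
    injective (fun v : V => cls (vertex_div v)) ->
  (Lfun chi D1 1)`_0 = \sum_(v : V) chi (shift (cls (vertex_div v)) D1).
Proof.
move=> pt_inj; pose pt (v : V) := cls (vertex_div v).
have hE n : (\sum_(i < n) 'X^i : {poly R[i]})`_0 = (0 < n)%:R.
  case: n => [|n]; first by rewrite big_ord0 coef0.
  by rewrite coef_sum big_ord_recl big1 ?addr0 ?coefXn // => i _; rewrite coefXn.
rewrite /Lfun -(@fsbig_widen _ _ _ _ (pt @` setT)%classic) /=; last 2 first.
- by move=> _ [v _ <-] /=; rewrite pdeg_cls ddeg_vertex_div.
- move=> c [/= c1 cN]; suff /eqP-> : h c == 0%N by rewrite big_ord0 scaler0.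
  rewrite -leqn0 leqNgt; apply/negP => /h_gt0P[D effD Dc]; apply: cN.
  have [|v Dv] := effective_deg1 effD; first by rewrite -pdeg_cls Dc.
  by exists v => //; rewrite /pt -Dv.
rewrite fsbig_image; last by move=> v w _ _; apply: pt_inj.
rewrite (fsbigE (index_enum V)) ?index_enum_uniq //=; last first.
  by move=> v _; rewrite mem_index_enum.
rewrite (eq_bigl xpredT) => [|v]; last by rewrite in_setT.
rewrite coef_sum; apply: eq_bigr => v _; rewrite coefZ hE.
have -> : (0 < h (pt v))%N by apply/h_gt0P; exists (vertex_div v) => // x; rewrite ffunE.
by rewrite mulr1.
Qed.

End EffectiveClasses.

(** * Transporting principal divisors along an isomorphism of Jacobians *)

Section ShiftedClasses.
Variables (X : multigraph) (D1 : Pic1 X).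

(** The Abel-Jacobi map with base class [D1], extended to an additive map on
    divisors of every degree. *)
Definition jac_of (D : Div X) : Jac X := shift (cls D) D1.

Lemma jac_of_zmod : zmod_morphism jac_of.
Proof.
move=> D D'; apply: val_inj; rewrite /= !pdeg_cls !(raddfB (@cls X), raddfB (@ddeg X)) /=.
by rewrite mulrzBr opprB opprB addrACA [in RHS]addrACA [- (_ *~ _) + _]addrC.
Qed.

HB.instance Definition _ :=
  GRing.isZmodMorphism.Build (Div X) (Jac X) jac_of jac_of_zmod.

Lemma jac_of_eq0 (D : Div X) : ddeg D = 0 -> (jac_of D == 0) = principal D.
Proof.
move=> D0; rewrite -val_eqE /= pdeg_cls D0 mulr0z subr0 -(raddf0 (@cls X)).
apply/cls_eqP/asboolP => -[f fE]; exists f; first by rewrite -fE subr0.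
by rewrite subr0.
Qed.

Lemma div_sum_vertex_div (D : Div X) : D = \sum_v vertex_div v *~ D v.
Proof.
have mulE (E : Div X) (m : int) x : (E *~ m) x = E x * m.
  by case: m => m; rewrite ?NegzE ?mulrNz -?pmulrn ?ffunE ffunMnE -mulr_natr natz ?mulrN.
apply/ffunP => x; rewrite sum_ffunE (bigD1 x) //= mulE ffunE eqxx mul1r.
by rewrite big1 ?addr0 // => v vx; rewrite mulE ffunE eq_sym (negbTE vx) mul0r.
Qed.

Lemma jac_of_sum (D : Div X) : jac_of D = \sum_v jac_of (vertex_div v) *~ D v.
Proof.
by rewrite {1}[D]div_sum_vertex_div raddf_sum; apply: eq_bigr => v _; rewrite raddfMz.
Qed.

Lemma principal_ddeg (D : Div X) : principal D -> ddeg D = 0.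
Proof. by move=> /asboolP[f ->]; rewrite ddeg_lap_map. Qed.

End ShiftedClasses.

Lemma jac_of_vertex_div_inj (X : multigraph) (D1 : Pic1 X) :
    injective (fun v : vertex X => cls (vertex_div v)) ->
  injective (fun v => jac_of D1 (vertex_div v)).
Proof.
move=> cls_inj v w /(congr1 val) /=; rewrite !pdeg_cls !ddeg_vertex_div.
by move=> /addIr /cls_inj.
Qed.

Lemma perm_eq_map_surj (A B : finType) (T : eqType) (x : A -> T) (y : B -> T) :
    perm_eq [seq x a | a <- index_enum A] [seq y b | b <- index_enum B] ->
  forall a, exists b, y b = x a.
Proof.
move=> /perm_mem xy a; have : x a \in [seq x a | a <- index_enum A].
  by rewrite map_f // mem_index_enum.
by rewrite xy => /mapP[b _ ->]; exists b.
Qed.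

(** An isomorphism of Jacobians that matches the vertices through [F] matches
    all divisors through [F], because both Abel-Jacobi maps are additive; and a
    divisor of degree 0 is principal exactly when its image is 0. *)
Lemma principal_pull (X X' : multigraph) (D1 : Pic1 X) (D1' : Pic1 X')
    (phi : {additive Jac X' -> Jac X}) (F : vertex X' -> vertex X) (D : Div X) :
    injective phi -> bijective F ->
    (forall v, jac_of D1 (vertex_div (F v)) = phi (jac_of D1' (vertex_div v))) ->
  principal ([ffun v => D (F v)] : Div X') = principal D.
Proof.
move=> phi_inj F_bij phiF; pose D' : Div X' := [ffun v => D (F v)].
rewrite -/D'; have DD' : ddeg D' = ddeg D.
  rewrite /ddeg [RHS](reindex F) /=; last exact: onW_bij.
  by apply: eq_bigr => v _; rewrite ffunE.
have phiD : phi (jac_of D1' D') = jac_of D1 D.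
  rewrite !jac_of_sum raddf_sum [RHS](reindex F) /=; last exact: onW_bij.
  by apply: eq_bigr => v _; rewrite raddfMz ffunE phiF.
have [D0|D0] := eqVneq (ddeg D) 0.
  rewrite -(jac_of_eq0 D1) // -(jac_of_eq0 D1') ?DD' // -phiD.
  by rewrite -(inj_eq phi_inj) raddf0.
by apply/idP/idP => /principal_ddeg dD; case/eqP: D0; rewrite -dD ?DD'.
Qed.

Theorem corollary4p5 (R : realType) (X X' : multigraph)
    (satX : saturated X) (satX' : saturated X')
    (nobridgeX : forall e : edge X, ~ bridge e)
    (nobridgeX' : forall e : edge X', ~ bridge e)
    (D1 : Pic1 X) (D1' : Pic1 X')
    (phi : {additive Jac X' -> Jac X}) (phi_bij : bijective phi)
    (eqL : forall chi : Jac X -> R[i], is_character chi ->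
       Lfun chi D1 = Lfun (chi \o phi) D1') :
  graph_isomorphic X X'.
Proof.
have phi_inj := bij_inj phi_bij.
have cls_inj := cls_vertex_div_inj satX nobridgeX.
have cls_inj' := cls_vertex_div_inj satX' nobridgeX'.
pose x v := jac_of D1 (vertex_div v); pose y v := phi (jac_of D1' (vertex_div v)).
have x_inj : injective x := jac_of_vertex_div_inj cls_inj.
have y_inj : injective y := inj_comp phi_inj (jac_of_vertex_div_inj cls_inj').
have xy : perm_eq [seq x v | v <- index_enum (vertex X)]
                  [seq y v | v <- index_enum (vertex X')].
  apply: (@character_sums_perm_eq R) => chi chiP.
  rewrite !big_map.
  have := congr1 (fun L : int -> {poly R[i]} => (L 1)`_0) (eqL chi chiP).
  by rewrite /= !Lfun_deg1_coef0.
have [G GE] := choice (perm_eq_map_surj xy).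
rewrite perm_sym in xy; have [F FE] := choice (perm_eq_map_surj xy).
have GK : cancel G F by move=> v; apply: x_inj; rewrite FE GE.
have FK : cancel F G by move=> v; apply: y_inj; rewrite GE FE.
have F_bij : bijective F by exists G.
(* The lattices of principal divisors correspond under [F] and its inverse. *)
have pullF (D : Div X) : principal ([ffun v => D (F v)] : Div X') = principal D.
  exact: (principal_pull _ phi_inj F_bij FE).
have pullG (D : Div X') : principal D -> principal ([ffun v => D (G v)] : Div X).
  rewrite -pullF; suff -> : [ffun v => [ffun w => D (G w)] (F v)] = D by [].
  by apply/ffunP => v; rewrite !ffunE FK.
apply: (@adjacency_graph_isomorphic _ _ G) => [|v w]; first by exists F.
apply: adjacency_pull => //; first exact: can_inj GK.
apply/eqP; rewrite eqn_leq; apply/andP; split; last first.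
  by apply: valency_le_pull => //; exact: can_inj GK.
rewrite -[leqRHS]/(valency w) -{2}[w]GK.
by apply: valency_le_pull => // [|D]; [exact: can_inj FK|rewrite pullF].
Qed.
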